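(* Let $k=k(n)$ be positive integers with $k=O(n)$ and let $\varepsilon>0$. Throw $k$ balls independently and uniformly at random into $n$ bins, and let $M(n,k)$ be the maximum number of balls in a single bin. Then with probability tending to $1$ as $n\to\infty$, $$\lfloor \nu(n,k)-\varepsilon\rfloor\le M(n,k)\le \lfloor \nu(n,k)+\varepsilon\rfloor .$$
   Context: $\log$ is the natural logarithm. For $n,k\in\mathbb N$, $\nu(n,k)$ is the unique positive zero of $f_{n,k}(x)=x\log k+x-(x+1/2)\log x-(x-1)\log n$. *)

(* Defs.v *)
From HB Require Import structures.
From mathcomp Require Export all_boot all_order all_algebra.
From mathcomp Require Export all_classical all_reals all_analysis.
From mathcomp Require ring lra.

Set Implicit Arguments.
Unset Strict Implicit.
Unset Printing Implicit Defensive.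

Export Order.TTheory GRing.Theory Num.Theory.
Export numFieldNormedType.Exports.

Open Scope classical_set_scope.
Open Scope ring_scope.

Definition fnk (R : realType) (n k : nat) (x : R) : R :=
  x * ln k%:R + x - (x + 2^-1) * ln x - (x - 1) * ln n%:R.

(* Well defined for positive n and k by [fnk_ex] and [fnk_uniq] below; the
   value is irrelevant when n or k is zero. *)
Definition nu (R : realType) (n k : nat) : R :=
  xget 0 [set x : R | 0 < x /\ fnk n k x = 0].

Section NuWellDefined.
Import ring lra.
Variables (R : realType) (n k : nat).
Hypotheses (n_gt0 : (0 < n)%N) (k_gt0 : (0 < k)%N).

Let lnn_ge0 : 0 <= ln n%:R :> R.
Proof. by apply: ln_ge0; rewrite ler1n. Qed.

Let lnk_ge0 : 0 <= ln k%:R :> R.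
Proof. by apply: ln_ge0; rewrite ler1n. Qed.

Lemma fnk_ex : exists x : R, 0 < x /\ fnk n k x = 0.
Proof.
pose b : R := expR 2 * (k%:R * n%:R).
have k1 : 1 <= k%:R :> R by rewrite ler1n.
have n1 : 1 <= n%:R :> R by rewrite ler1n.
have e1 : 1 <= expR 2 :> R by rewrite ltW ?expR_gt1.
have kn_n : n%:R <= k%:R * n%:R :> R by rewrite ler_peMl// (le_trans _ n1).
have b_n : n%:R <= b.
  by rewrite (le_trans kn_n)// /b ler_peMl// (le_trans _ kn_n)// (le_trans _ n1).
have b1 : 1 <= b by exact: le_trans b_n.
have lnb : ln b = 2 + (ln k%:R + ln n%:R).
  by rewrite /b !lnM ?posrE ?mulr_gt0 ?expR_gt0 ?ltr0n// expRK.
clearbody b.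
have f1 : 0 <= fnk n k (1 : R).
  by rewrite /fnk ln1 subrr mul0r mulr0 !subr0 mul1r addr_ge0.
have fb : fnk n k b <= 0.
  rewrite /fnk lnb.
  have := @ln_sublinear R n%:R; rewrite ltr0n => /(_ n_gt0) lnn.
  have blnn : 0 <= b * ln n%:R by rewrite mulr_ge0// (le_trans _ b1).
  move: lnn blnn b_n lnn_ge0 lnk_ge0.
  move: (ln n%:R : R) (ln k%:R : R) (n%:R : R) => p q m ? ? ? ? ?; lra.
have cf : {within `[1, b], continuous (fnk n k : R -> R)}.
  apply: continuous_in_subspaceT => x /[!inE]/= /[!in_itv]/= /andP[x1 _].
  have x0 : 0 < x by exact: lt_le_trans x1.
  rewrite /fnk; apply: cvgB.
    apply: cvgB.
      by apply: cvgD; [apply: cvgM; [exact: cvg_id|exact: cvg_cst]|exact: cvg_id].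
    apply: cvgM; last exact: continuous_ln.
    by apply: cvgD; [exact: cvg_id|exact: cvg_cst].
  apply: cvgM; last exact: cvg_cst.
  by apply: cvgB; [exact: cvg_id|exact: cvg_cst].
have [|x /[!in_itv]/= /andP[x1 _] fx] := IVT b1 cf (v := 0).
  by rewrite ge_min fb orbT/= le_max f1.
by exists x; split => //; exact: lt_le_trans x1.
Qed.

Lemma fnk_uniq (x y : R) : 0 < x -> 0 < y ->
  fnk n k x = 0 -> fnk n k y = 0 -> x = y.
Proof.
wlog xy : x y / x <= y.
  move=> H x0 y0 fx fy; have [|/ltW] := leP x y => xy; first exact: H.
  by apply/esym; exact: H.
move=> x0 y0 fx fy; apply/eqP; apply: contraT => neq.
have {neq} xy' : x < y by rewrite lt_neqAle neq.
have lnD : y - x <= y * (ln y - ln x).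
  have xdy : 0 < x / y by rewrite divr_gt0.
  have := @le_ln1Dx R (x / y - 1); rewrite addrCA subrr addr0.
  have -> : -1 < x / y - 1 by lra.
  move=> /(_ isT); rewrite ln_div ?posrE// => h.
  have : y * (ln x - ln y) <= y * (x / y - 1) by rewrite ler_pM2l.
  have -> : y * (x / y - 1) = x - y by field; rewrite gt_eqF.
  by rewrite !mulrBr => ?; lra.
have lnx := ln_sublinear x0.
have : y * fnk n k x - x * fnk n k y = 0 by rewrite fx fy !mulr0 subrr.
rewrite /fnk.
move: (ln n%:R : R) lnn_ge0 => p p0.
set a := ln x in lnx lnD *; set D := ln y - a in lnD.
have -> : ln y = a + D by rewrite /D addrCA subrr addr0.
move=> E.
have {}E : x * (y * D) + 2^-1 * x * D + (y - x) * (p - 2^-1 * a) = 0.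
  by rewrite -[RHS]E; field.
have D0 : 0 < D by rewrite /D subr_gt0 ltr_ln ?posrE.
have h1 : x * (y - x) <= x * (y * D) by rewrite ler_pM2l.
have h2 : 0 < x * D by rewrite mulr_gt0.
have h3 : 0 < (y - x) * (x + p - 2^-1 * a).
  by rewrite mulr_gt0 ?subr_gt0//; lra.
by lra.
Qed.

Lemma nuP (x : R) : (0 < x /\ fnk n k x = 0) <-> x = nu R n k.
Proof.
rewrite /nu; case: xgetP => [y _ [y0 fy]|H].
  by split=> [[x0 fx]|->//]; exact: fnk_uniq.
by have [y Hy] := fnk_ex; case: (H y).
Qed.

End NuWellDefined.

Definition mutually_independent (R : realType) (d d' : measure_display)
    (T : measurableType d) (T' : measurableType d') (P : probability T R)
    (I : finType) (X : I -> {RV P >-> T'}) : Prop :=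
  forall (J : {set I}) (A : I -> set T'), (forall i, measurable (A i)) ->
    P (\bigcap_(i in [set` J]) (X i @^-1` A i)) =
    (\prod_(i in J) P (X i @^-1` A i))%E.

(* Bins are labelled by the naturals 0, ..., n - 1. *)
Definition uniform_bin (R : realType) (d : measure_display)
    (T : measurableType d) (P : probability T R) (n : nat)
    (X : {RV P >-> nat}) : Prop :=
  forall j : nat, (j < n)%N -> P (X @^-1` [set j]) = (n%:R^-1)%:E.

Definition max_load (n k : nat) (b : 'I_k -> nat) : nat :=
  (\max_(j < n) #|[set i : 'I_k | b i == j]%SET|)%N.

(* Main.v *)
Require Import Defs.
Import ring lra.

(* By Stirling's formula, [expR (fnk n k m)] is, up to bounded factors, the
   expected number of bins holding [m] balls.  The slope of [fnk n k] at its
   zero [x = nu R n k] is at most [- L], where [L = ln (n x / k)], and the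
   equation [x L = ln n + x - (ln x) / 2] forces [L] to tend to infinity
   uniformly in [k <= C n].  Hence [fnk n k m] tends to -oo for
   [m >= x + eps], and a union bound gives the upper estimate; it tends to +oo
   for [2 <= m <= x - eps < m + 1], and the second moment method, applied to
   the number of bins holding exactly [m] balls, gives the lower one.  Counting
   exactly [m] balls matters: the number of monochromatic [m]-subsets of balls
   has too large a variance.  The equation also gives [m <= ln n] and
   [k >= sqrt n / e], so that 'C(k, m) is comparable to k^m / m!. *)

(** * Counting assignments of balls to bins *)

Lemma leq_card_bigcup (I T : finType) (Q : pred I) (F : I -> {set T}) :
  (#|(\bigcup_(i | Q i) F i)%SET| <= \sum_(i | Q i) #|F i|)%N.
Proof.
apply: (big_ind2 (fun (A : {set T}) n => #|A| <= n)%N); rewrite ?cards0//.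
by move=> A a B b Aa Bb; exact: leq_trans (leq_card_setU A B) (leq_add Aa Bb).
Qed.

Section Fibers.
Variables (I J : finType).
Implicit Types (b : {ffun I -> J}) (S : {set I}) (j : J).

Definition fiber b j : {set I} := [set i | b i == j]%SET.

Lemma in_fiber b j i : (i \in fiber b j) = (b i == j).
Proof. by rewrite inE. Qed.

Lemma card_familyE (F : I -> pred J) :
  #|family F| = (\prod_(i : I) #|F i|)%N.
Proof. by rewrite card_family foldrE big_map big_enum. Qed.

Lemma card_sub_fiber S j :
  #|[set b : {ffun I -> J} | S \subset fiber b j]%SET| = (#|J| ^ #|~: S|)%N.
Proof.
transitivity #|family (fun i => if i \in S then pred1 j else predT)|.
  apply: eq_card => b; rewrite inE; apply/fintype.subsetP/familyP => H i.
    by case: ifPn => [/H|//]; rewrite in_fiber.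
  by move=> iS; have := H i; rewrite iS in_fiber.
rewrite card_familyE (bigID (mem S))/= big1 ?mul1n; last first.
  by move=> i ->; rewrite card1.
rewrite (eq_bigr (fun=> #|J|)); last by move=> i /negPf ->.
by rewrite prod_nat_const; congr expn; apply: eq_card => i; rewrite !inE.
Qed.

Lemma card_fiber_eq S j :
  #|[set b : {ffun I -> J} | fiber b j == S]%SET| = (#|J|.-1 ^ #|~: S|)%N.
Proof.
transitivity #|family (fun i => if i \in S then pred1 j else predC1 j)|.
  apply: eq_card => b; rewrite inE; apply/eqP/familyP => [<- i|H].
    by rewrite in_fiber; case: ifPn => /=.
  apply/setP => i; rewrite in_fiber; have := H i.
  by case: ifPn => _ /[!inE] => [->|/negPf ->].
rewrite card_familyE (bigID (mem S))/= big1 ?mul1n; last first.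
  by move=> i ->; rewrite card1.
rewrite (eq_bigr (fun=> #|J|.-1)); last first.
  by move=> i /negPf ->; rewrite cardC1.
by rewrite prod_nat_const; congr expn; apply: eq_card => i; rewrite !inE.
Qed.

(** For disjoint S and S' this is an equality: the balls outside both sets choose among the other
    [#|J| - 2] bins. If S and S' meet, no assignment qualifies. *)
Lemma card_fiber_eq2 S S' j j' : j != j' ->
  (#|[set b : {ffun I -> J} | (fiber b j == S) && (fiber b j' == S')]%SET|
    <= (#|J| - 2) ^ (#|I| - (#|S| + #|S'|)))%N.
Proof.
move=> jj'.
have [SS'|SS'] := boolP [disjoint S & S']; last first.
  rewrite (_ : [set _ | _]%SET = finset.set0) ?cards0//.
  apply/setP => b; rewrite !inE; apply/negP => /andP[/eqP Sb /eqP Sb'].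
  move/negP: SS'; apply; rewrite -Sb -Sb' disjoint_subset; apply/fintype.subsetP => i.
  by rewrite in_fiber inE in_fiber => /eqP->.
have <- : #|~: (S :|: S')| = (#|I| - (#|S| + #|S'|))%N.
  rewrite -(cardsC (S :|: S')) cardsU (disjoint_setI0 SS') cards0 subn0.
  by rewrite addKn.
have -> : (#|J| - 2 = #|[predC (pred2 j j')]|)%N.
  rewrite -(cardC (pred2 j j')) card2 jj' addKn.
  by apply: eq_card => i; rewrite !inE.
apply: eq_leq.
transitivity #|family (fun i => if i \in S then pred1 j else
   if i \in S' then pred1 j' else [predC (pred2 j j')])|.
  apply: eq_card => b; rewrite inE; apply/andP/familyP.
    move=> [/eqP Sb /eqP Sb'] i; rewrite -Sb -Sb' !in_fiber.
    case: ifPn => //= bj; case: ifPn => //= bj'.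
    by rewrite !inE negb_or bj bj'.
  move=> H; split; apply/eqP/setP => i; have := H i; rewrite in_fiber.
    case: ifPn => _; first by rewrite inE.
    case: ifPn => _ /[!inE] => [/eqP->|/norP[/negPf->]//].
    by rewrite eq_sym (negPf jj').
  case: ifPn => iS.
    by rewrite inE => /eqP->; rewrite (negPf jj') (disjointFr SS' iS).
  by case: ifPn => _ /[!inE] => [/eqP->|/norP[_ /negPf->]//]; rewrite eqxx.
rewrite card_familyE (bigID (mem (S :|: S')))/= big1 ?mul1n; last first.
  by move=> i; rewrite inE; case: ifPn => [_ _|_ /= ->]; rewrite card1.
rewrite (eq_bigr (fun=> #|[predC (pred2 j j')]|)); last first.
  by move=> i; rewrite inE negb_or => /andP[/negPf-> /negPf->].
by rewrite prod_nat_const; congr (_ ^ _)%N; apply: eq_card => i; rewrite finset.in_setC.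
Qed.

Lemma card_fiber_card_eq j m :
  #|[set b : {ffun I -> J} | #|fiber b j| == m]%SET|
  = ('C(#|I|, m) * #|J|.-1 ^ (#|I| - m))%N.
Proof.
rewrite -sum1_card.
rewrite (partition_big (fun b => fiber b j) (fun S => #|S| == m))/=; last first.
  by move=> b; rewrite inE.
rewrite (eq_bigr (fun=> #|J|.-1 ^ (#|I| - m))%N) => [|S /eqP Sm].
  rewrite sum_nat_const; congr muln; rewrite -card_draws.
  by apply: eq_card => S; rewrite !inE.
transitivity #|[set b : {ffun I -> J} | fiber b j == S]%SET|; last first.
  by rewrite card_fiber_eq -Sm -(cardsC S) addKn.
rewrite -sum1_card; apply: eq_bigl => b.
by rewrite !inE; have [->|] := eqVneq (fiber b j) S; rewrite ?Sm ?eqxx ?andbF.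
Qed.

(** Overlapping pairs of m-subsets are counted as well. This leaves the square of a binomial
    coefficient, which cancels against the squared mean. *)
Lemma card_fiber_card_eq2 j j' m : j != j' ->
  (#|[set b : {ffun I -> J} | (#|fiber b j| == m) && (#|fiber b j'| == m)]%SET|
  <= 'C(#|I|, m) ^ 2 * (#|J| - 2) ^ (#|I| - (m + m)))%N.
Proof.
move=> jj'; rewrite -sum1_card.
rewrite (partition_big (fun b => (fiber b j, fiber b j'))
  (fun U => (#|U.1| == m) && (#|U.2| == m)))/=; last first.
  by move=> b; rewrite inE.
apply: (@leq_trans (\sum_(U : {set I} * {set I} | (#|U.1| == m) && (#|U.2| == m))
   (#|J| - 2) ^ (#|I| - (m + m)))); last first.
  rewrite sum_nat_const leq_mul2r; apply/orP; right.
  rewrite expnS expn1 -card_draws -cardsX; apply: eq_leq.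
  by apply: eq_card => U; rewrite !inE.
apply: leq_sum => -[S S'] /andP[/= /eqP Sm /eqP Sm'].
have := card_fiber_eq2 S S' j j' jj'; rewrite Sm Sm'; apply: leq_trans.
rewrite -sum1_card; apply: eq_leq; apply: eq_bigl => b.
rewrite !inE xpair_eqE; have [->|] := eqVneq (fiber b j) S; rewrite ?andbF//=.
have [->|] := eqVneq (fiber b j') S'; rewrite ?andbF//.
by rewrite Sm Sm' eqxx.
Qed.

(* Union bound over the bins [j] and the [m]-subsets of balls lying in [j]. *)
Lemma card_exists_fiber_ge m :
  (#|[set b : {ffun I -> J} | [exists j, m <= #|fiber b j|]]%SET|
   <= #|J| * ('C(#|I|, m) * #|J| ^ (#|I| - m)))%N.
Proof.
apply: (@leq_trans #|(\bigcup_(j : J) \bigcup_(S : {set I} | #|S| == m)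
   [set b : {ffun I -> J} | S \subset fiber b j])%SET|).
  apply/subset_leq_card/fintype.subsetP => b; rewrite inE => /existsP[j].
  rewrite cardE => mj; apply/finset.bigcupP; exists j => //.
  (* The first m balls of the bin serve as the required m-subset. *)
  pose s := take m (enum (fiber b j)).
  have us : uniq s by rewrite take_uniq// enum_uniq.
  apply/finset.bigcupP; exists [set i in s]%SET.
    by rewrite cardsE (card_uniqP us) size_takel.
  rewrite inE; apply/fintype.subsetP => i; rewrite inE => /mem_take.
  by rewrite mem_enum.
apply: leq_trans (leq_card_bigcup _ _ _ _) _.
apply: (@leq_trans (\sum_(j : J) 'C(#|I|, m) * #|J| ^ (#|I| - m))); last first.
  by rewrite sum_nat_const.
apply: leq_sum => j _; apply: leq_trans (leq_card_bigcup _ _ _ _) _.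
rewrite (eq_bigr (fun=> #|J| ^ (#|I| - m))%N).
  rewrite sum_nat_const; apply: eq_leq; congr muln; rewrite -card_draws.
  by apply: eq_card => S; rewrite !inE.
by move=> S /eqP <-; rewrite card_sub_fiber -(cardsC S) addKn.
Qed.
End Fibers.
Arguments fiber {I J}.

(** * The second moment method *)

(** Chebyshev's inequality for the uniform measure, with denominators cleared: the right side is the
    sum of the squared deviations from mu, and every zero of N contributes mu^2 to it. *)
Lemma chebyshev_zero_count (R : realFieldType) (T : finType) (N : T -> R) (mu : R) :
  \sum_b N b = #|T|%:R * mu ->
  #|[set b | N b == 0]%SET|%:R * mu ^+ 2 <= \sum_b N b ^+ 2 - #|T|%:R * mu ^+ 2.
Proof.
move=> N1.
have -> : \sum_b N b ^+ 2 - #|T|%:R * mu ^+ 2 = \sum_b (N b - mu) ^+ 2.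
  rewrite [RHS](eq_bigr (fun b => N b ^+ 2 + (- (2 * mu) * N b + mu ^+ 2))); last first.
    by move=> b _; ring.
  rewrite !big_split/= -mulr_sumr N1 sumr_const -mulr_natl; ring.
rewrite (bigID (mem [set b | N b == 0]%SET))/= ler_wpDr//.
  by apply: sumr_ge0 => b _; exact: sqr_ge0.
rewrite (eq_bigr (fun=> mu ^+ 2)); first by rewrite sumr_const mulr_natl.
by move=> b; rewrite inE => /eqP ->; ring.
Qed.

Lemma natr_sum_eqb (R : pzSemiRingType) (T : finType) (Q : pred T) :
  \sum_(b : T) (Q b)%:R = #|[set b | Q b]%SET|%:R :> R.
Proof.
by rewrite -natr_sum -sum1dep_card [in RHS]big_mkcond; congr (_%:R).
Qed.

(** Comparing the powers with exponent k - 2m reduces this to n (n - 2) <= (n - 1)^2. It bounds the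
    correlation of two bins by (n / (n - 1))^(2m). *)
Lemma second_moment_ratio (n k m : nat) : (2 <= n)%N -> (m + m <= k)%N ->
  ((n - 2) ^ (k - (m + m)) * n ^ k * n.-1 ^ (m + m) <=
   (n.-1 ^ (k - m)) ^ 2 * n ^ (m + m))%N.
Proof.
move=> n2 mk; set r := (k - (m + m))%N.
have -> : k = (m + m + r)%N by rewrite subnKC.
have -> : (m + m + r - m = m + r)%N by rewrite -addnA addKn.
case: n n2 => [//|[//|n _]]; rewrite subn2 [_.+2.-2]/= [_.-1]/=.
have -> : (n ^ r * n.+2 ^ (m + m + r) * n.+1 ^ (m + m) =
  (n * n.+2) ^ r * (n.+2 ^ (m + m) * n.+1 ^ (m + m)))%N.
  by rewrite expnMn !expnD; ring.
have -> : ((n.+1 ^ (m + r)) ^ 2 * n.+2 ^ (m + m) =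
  (n.+1 * n.+1) ^ r * (n.+2 ^ (m + m) * n.+1 ^ (m + m)))%N.
  by rewrite expnMn !expnD; ring.
rewrite leq_mul2r; apply/orP; right.
have [->|r0] := posnP r; first by rewrite !expn0.
by rewrite leq_exp2r// (_ : n.+1 * n.+1 = (n * n.+2).+1)%N//; ring.
Qed.

(* Second moment method for the number of bins holding exactly [m] balls,
   whose mean is [mu]. *)
Lemma card_no_fiber_eq (R : realFieldType) (I J : finType) (m : nat) (mu : R) :
  (2 <= #|J|)%N -> (m + m <= #|I|)%N ->
  mu = (#|J| * ('C(#|I|, m) * #|J|.-1 ^ (#|I| - m)))%:R
    / (#|J| ^ #|I|)%:R ->
  #|[set b : {ffun I -> J} | [forall j, #|fiber b j| != m]]%SET|%:R
    / (#|J| ^ #|I|)%:R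
  <= mu^-1 + ((#|J|%:R / #|J|.-1%:R) ^+ (m + m) - 1).
Proof.
move=> n2 mk muE.
pose N (b : {ffun I -> J}) : R := \sum_(j : J) (#|fiber b j| == m)%:R.
set tot : R := (#|J| ^ #|I|)%:R; set q := ('C(#|I|, m) * #|J|.-1 ^ (#|I| - m))%N.
have n1 : (0 < #|J|.-1)%N by case: #|J| n2 => [//|[]].
have n0 : (0 < #|J|)%N by exact: leq_trans n2.
have q0 : (0 < q)%N.
  by rewrite muln_gt0 bin_gt0 expn_gt0 n1 andbT (leq_trans (leq_addr _ _) mk).
have tot0 : 0 < tot by rewrite ltr0n expn_gt0 n0.
have mu0 : 0 < mu by rewrite muE divr_gt0// ltr0n muln_gt0 n0.
have cardT' : #|{ffun I -> J}|%:R = tot by rewrite card_ffun.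
have N1 : \sum_b N b = #|{ffun I -> J}|%:R * mu.
  rewrite exchange_big/= (eq_bigr (fun=> q%:R)); last first.
    by move=> j _; rewrite natr_sum_eqb card_fiber_card_eq.
  rewrite sumr_const -mulrnA mulnC cardT' muE -/tot mulrCA mulfV ?mulr1//.
  by rewrite gt_eqF.
(* The square is expanded over pairs of bins: the diagonal gives the first moment, the other pairs
   fall under [card_fiber_card_eq2]. *)
have N2 : \sum_b N b ^+ 2 <= (#|J| * q)%:R +
    (#|J| ^ 2 * ('C(#|I|, m) ^ 2 * (#|J| - 2) ^ (#|I| - (m + m))))%:R.
  rewrite (eq_bigr (fun b => \sum_(j : J) \sum_(j' : J)
    ((#|fiber b j| == m) && (#|fiber b j'| == m))%:R)); last first.
    move=> b _; rewrite expr2 mulr_suml; apply: eq_bigr => j _.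
    by rewrite mulr_sumr; apply: eq_bigr => j' _; rewrite -mulnb natrM.
  rewrite exchange_big/=.
  set c2 := ('C(#|I|, m) ^ 2 * (#|J| - 2) ^ (#|I| - (m + m)))%N.
  apply: (@le_trans _ _ (\sum_(j : J) (q + #|J| * c2)%:R)); last first.
    by rewrite sumr_const -mulrnA mulnC -natrD mulnDr mulnA.
  apply: ler_sum => j _; rewrite exchange_big/= (bigD1 j)//= natrD lerD//.
    rewrite natr_sum_eqb ler_nat /q -(card_fiber_card_eq I J j m) subset_leq_card//.
    by apply/fintype.subsetP => b; rewrite !inE andbb.
  apply: (@le_trans _ _ (\sum_(j' : J | j' != j) c2%:R)).
    apply: ler_sum => j' jj'; rewrite natr_sum_eqb ler_nat.
    by apply: card_fiber_card_eq2; rewrite eq_sym.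
  rewrite sumr_const -mulrnA mulnC ler_nat leq_mul2r; apply/orP; right.
  exact: max_card.
have := chebyshev_zero_count R _ N mu N1; rewrite cardT'.
have -> : [set b | N b == 0]%SET =
   [set b : {ffun I -> J} | [forall j, #|fiber b j| != m]]%SET.
  apply/setP => b; rewrite !inE psumr_eq0; last by move=> j _; rewrite ler0n.
  apply/allP/forallP => [H j|H j _].
    by have := H j; rewrite mem_index_enum pnatr_eq0 eqb0 => /(_ isT).
  by rewrite pnatr_eq0 eqb0 H.
set Z := #|_| => HZ.
have ratio := second_moment_ratio #|J| #|I| m n2 mk.
have {}ratio : (#|J| ^ 2 * ('C(#|I|, m) ^ 2 * (#|J| - 2) ^ (#|I| - (m + m))))%:R
   <= (#|J|%:R / #|J|.-1%:R) ^+ (m + m) * (tot * mu ^+ 2).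
  have -> : tot * mu ^+ 2 = (#|J| ^ 2 * q ^ 2)%:R / tot.
    by rewrite muE -/q -/tot !natrM !natrX; field; rewrite gt_eqF.
  rewrite expr_div_n mulrA ler_pdivlMr// mulrAC ler_pdivlMr ?exprn_gt0 ?ltr0n//.
  rewrite -!natrX -!natrM ler_nat.
  move: ratio; rewrite /q => ratio.
  have := leq_mul (leqnn (#|J| ^ 2 * 'C(#|I|, m) ^ 2)) ratio => {}ratio.
  apply: leq_trans (leq_trans _ ratio) _.
    by apply: eq_leq; ring.
  by rewrite [(('C(_, _) * _) ^ 2)%N]expnMn; apply: eq_leq; ring.
have tm0 : 0 < tot * mu ^+ 2 by rewrite mulr_gt0// exprn_gt0.
(* After this scaling the diagonal part [tot * mu] accounts for [mu^-1], and the other pairs minus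
   the squared mean for the second summand. *)
rewrite -(ler_pM2r tm0).
have -> : Z%:R / tot * (tot * mu ^+ 2) = Z%:R * mu ^+ 2.
  by field; rewrite gt_eqF.
have -> : (mu^-1 + ((#|J|%:R / #|J|.-1%:R) ^+ (m + m) - 1)) * (tot * mu ^+ 2) =
  tot * mu + ((#|J|%:R / #|J|.-1%:R) ^+ (m + m) * (tot * mu ^+ 2) - tot * mu ^+ 2).
  by rewrite mulrDl mulrBl mul1r; congr (_ + _); field; rewrite gt_eqF.
have E : (#|J| * q)%:R = tot * mu by rewrite muE -/q -/tot mulrCA mulfV ?mulr1// gt_eqF.
rewrite E in N2.
by lra.
Qed.

(** * Stirling bounds *)

Section LogInequalities.
Variable R : realType.
Implicit Types x y t : R.

(** This is ln (1 + u) <= u at u = x / y - 1. *)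
Lemma ln_sub_ge x y : 0 < x -> 0 < y -> y - x <= y * (ln y - ln x).
Proof.
move=> x0 y0.
have xy : 0 < x / y by rewrite divr_gt0.
have := @le_ln1Dx R (x / y - 1); rewrite addrCA subrr addr0.
have -> : -1 < x / y - 1 by lra.
move=> /(_ isT); rewrite ln_div ?posrE// => h.
have : y * (ln x - ln y) <= y * (x / y - 1) by rewrite ler_pM2l.
have -> : y * (x / y - 1) = x - y by field; rewrite gt_eqF.
by rewrite !mulrBr => ?; lra.
Qed.

Lemma ge1_derive_ge0 (f g : R -> R) :
  (forall t, 1 <= t -> is_derive t 1 f (g t)) -> (forall t, 1 <= t -> 0 <= g t) ->
  f 1 = 0 -> forall t, 1 <= t -> 0 <= f t.
Proof.
move=> fg g0 f0 t t0.
have cf : {within `[1, t], continuous f}.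
  apply: derivable_within_continuous => x /[!in_itv]/= /andP[x0 _].
  by have := fg _ x0; case.
have := @MVT_segment R f g 1 t t0.
case=> [x /[!in_itv]/= /andP[x0 _]|//|c /[!in_itv]/= /andP[c0 _]].
  by apply: fg; exact: ltW.
by rewrite f0 subr0 => ->; rewrite mulr_ge0 ?g0 ?subr_ge0.
Qed.

(** The rational function 2 (t - 1) / (t + 1) is the first diagonal Padé approximant of ln at 1. The
    difference f of the two sides vanishes at 1 and has derivative g >= 0. *)
Lemma ln_ge_pade t : 1 <= t -> 2 * (t - 1) <= (t + 1) * ln t.
Proof.
move=> t1; rewrite -subr_ge0.
pose f (u : R) := (u + 1) * ln u - 2 * (u - 1).
pose g (u : R) := ln u + u^-1 - 1.
apply: (ge1_derive_ge0 f g _ _ _ t t1) => [u u1|u u1|].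
- have u0 : 0 < u by lra.
  have dln := is_derive1_ln u0.
  rewrite /f; apply: is_derive_eq. rewrite /g /GRing.scale/=; field.
  by rewrite gt_eqF.
- have u0 : 0 < u by lra.
  have := ln_sub_ge 1 u ltr01 u0; rewrite ln1 subr0 /g => h.
  rewrite -(ler_pM2l u0) mulr0 mulrBr mulrDr mulfV ?gt_eqF//; lra.
- by rewrite /f ln1 subrr !mulr0 subrr.
Qed.

Lemma ln_le_half_sub_inv t : 1 <= t -> ln t <= (t - t^-1) / 2.
Proof.
move=> t1; rewrite -subr_ge0.
pose f (u : R) := (u - u^-1) / 2 - ln u.
pose g (u : R) := (1 - u^-1) ^+ 2 / 2.
apply: (ge1_derive_ge0 f g _ _ _ t t1) => [u u1|u u1|].
- have u0 : 0 < u by lra.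
  have dln := is_derive1_ln u0.
  have un0 : u != 0 by rewrite gt_eqF.
  have dinv := @is_deriveV R id u 1 1 un0 (is_derive_id u (1 : R)).
  rewrite /f; apply: is_derive_eq. rewrite /g /GRing.scale/=; field.
  by rewrite gt_eqF.
- by rewrite /g divr_ge0// sqr_ge0.
- by rewrite /f ln1 invr1 subrr mul0r subrr.
Qed.

(** The Padé bound at t = (x + 1) / x. It makes [stirling_err] nonincreasing. *)
Lemma ln_succ_ge (x : R) : 0 < x -> 1 <= (x + 2^-1) * (ln (x + 1) - ln x).
Proof.
move=> x0; have x1 : 0 < x + 1 by lra.
have t1 : 1 <= (x + 1) / x by rewrite ler_pdivlMr//; lra.
have := ln_ge_pade _ t1; rewrite ln_div ?posrE//.
have -> : 2 * ((x + 1) / x - 1) = 2 / x by field; rewrite gt_eqF.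
have -> : (x + 1) / x + 1 = 2 / x * (x + 2^-1) by field; rewrite gt_eqF.
have : 0 < 2 / x by rewrite divr_gt0.
by move: (2 / x) => c c0; rewrite -mulrA -{1}[c]mulr1 ler_pM2l.
Qed.

(** The bound [ln_le_half_sub_inv] is taken at the square root of (x + 1) / x, which gives ln (x +
    1) - ln x <= 1 / s with s^2 = x (x + 1). The error is left as a difference so that it
    telescopes. *)
Lemma ln_succ_le (x : R) : 0 < x ->
  (x + 2^-1) * (ln (x + 1) - ln x) <= 1 + (x^-1 - (x + 1)^-1) / 8.
Proof.
move=> x0; have x1 : 0 < x + 1 by lra.
set p := Num.sqrt x; set r := Num.sqrt (x + 1).
have p0 : 0 < p by rewrite sqrtr_gt0.
have r0 : 0 < r by rewrite sqrtr_gt0.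
have pp : p * p = x by rewrite -expr2 sqr_sqrtr// ltW.
have rr : r * r = x + 1 by rewrite -expr2 sqr_sqrtr// ltW.
have pr : p <= r by rewrite ler_sqrt; lra.
have t1 : 1 <= r / p by rewrite ler_pdivlMr// mul1r.
have := ln_le_half_sub_inv _ t1; rewrite ln_div ?posrE// invf_div.
have -> : (r / p - p / r) / 2 = (p * r)^-1 / 2.
  have -> : (p * r)^-1 = (r * r - p * p) / (p * r).
    by rewrite rr pp addrAC subrr add0r div1r.
  by field; rewrite !gt_eqF.
move=> h.
have -> : ln (x + 1) - ln x = 2 * (ln r - ln p).
  by rewrite -rr -pp !lnM ?posrE//; ring.
have s0 : 0 < p * r by rewrite mulr_gt0.
have ss : (p * r) ^+ 2 = x * (x + 1) by rewrite -rr -pp; ring.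
have -> : x^-1 - (x + 1)^-1 = ((p * r) ^+ 2)^-1.
  by rewrite ss; field; rewrite !gt_eqF.
move: (p * r) s0 ss h => s s0 ss h.
(* Holds since (x + 1/2)^2 = s^2 + 1/4; dividing by s then produces the error 1 / (8 s^2). *)
have h2 : x + 2^-1 <= s + (8 * s)^-1.
  rewrite -(@ler_pXn2r _ 2)// ?nnegrE; [|lra|]; last first.
    by rewrite addr_ge0 ?invr_ge0 ?mulr_ge0//; exact: ltW.
  have -> : (s + (8 * s)^-1) ^+ 2 = s ^+ 2 + 4^-1 + ((8 * s)^-1) ^+ 2.
    by field; rewrite gt_eqF.
  have := sqr_ge0 ((8 * s)^-1); rewrite ss; lra.
apply: (@le_trans _ _ ((x + 2^-1) * s^-1)).
  by rewrite ler_pM2l; lra.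
apply: (@le_trans _ _ ((s + (8 * s)^-1) * s^-1)).
  by rewrite ler_pM2r// invr_gt0.
by rewrite le_eqVlt; apply/orP; left; apply/eqP; field; rewrite gt_eqF.
Qed.

(** For positive m, the logarithm of m! / (sqrt m (m / e)^m), whose limit is ln (sqrt (2 pi)). *)
Definition stirling_err (m : nat) : R :=
  ln m`!%:R - (m%:R + 2^-1) * ln m%:R + m%:R.

Lemma stirling_errS (m : nat) : (0 < m)%N ->
  stirling_err m.+1 = stirling_err m
    + 1 - (m%:R + 2^-1) * (ln (m%:R + 1) - ln m%:R).
Proof.
move=> m0; rewrite /stirling_err factS natrM lnM ?posrE ?ltr0n ?fact_gt0//.
by rewrite -natr1; ring.
Qed.

(** The term 1 / (8 m) strengthens the induction: it absorbs the telescoping error of [ln_succ_le].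
    At m = 1 both bounds equal 1. *)
Lemma stirling_err_bounds (m : nat) : (0 < m)%N ->
  7 / 8 + m%:R^-1 / 8 <= stirling_err m <= 1.
Proof.
elim: m => [//|[_ _|m IH _]].
  by rewrite /stirling_err factE/= ln1 mulr0 invr1; lra.
have m0 : 0 < m.+1%:R :> R by rewrite ltr0n.
rewrite stirling_errS//.
have /andP[] := IH isT.
have := ln_succ_ge _ m0; have := ln_succ_le _ m0.
rewrite -(natr1 m.+1).
move: (m.+1%:R : R) (stirling_err m.+1) (ln (m.+1%:R + 1)) => x e l.
move=> h1 h2 h3 h4. apply/andP; split; lra.
Qed.
End LogInequalities.

(** * Tail estimates *)

Section Asymptotics.
Variable R : realType.
Implicit Types (x y : R) (n k m : nat).

(* The derivative of [fnk n k] at [x] is [- log_ratio n k x - 1 / (2 x)]. *)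
Definition log_ratio n k x : R := ln n%:R + ln x - ln k%:R.

(** The term - (ln x) / 2 is decreasing; the rest of [fnk] is concave with slope [- log_ratio n k x]
    at x. *)
Lemma fnk_le_tangent n k x y : 0 < x -> x <= y ->
  fnk n k y <= fnk n k x - (y - x) * log_ratio n k x.
Proof.
move=> x0 xy; have y0 : 0 < y by exact: lt_le_trans xy.
have h := ln_sub_ge R x y x0 y0.
have : ln x <= ln y by rewrite ler_ln ?posrE.
by rewrite /fnk /log_ratio; lra.
Qed.

Lemma fnk_nuP n k : (0 < n)%N -> (0 < k)%N ->
  0 < nu R n k /\ fnk n k (nu R n k) = 0.
Proof. by move=> n0 k0; exact/(nuP n0 k0). Qed.

Lemma nu_log_ratio n k : (0 < n)%N -> (0 < k)%N ->
  nu R n k * log_ratio n k (nu R n k) = ln n%:R + nu R n k - ln (nu R n k) / 2.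
Proof.
by move=> n0 k0; have [_] := fnk_nuP n k n0 k0; rewrite /fnk /log_ratio; lra.
Qed.

(** Write x for nu and L for the ratio. If x <= C e^A, then x L >= ln n >= A C e^A >= A x. Otherwise
    k <= C n gives L >= ln x - ln C > A. *)
Lemma log_ratio_large (C A : R) n k : 0 < C -> 0 <= A ->
  (0 < n)%N -> (0 < k)%N -> k%:R <= C * n%:R -> A * (C * expR A) <= ln n%:R ->
  A <= log_ratio n k (nu R n k).
Proof.
move=> C0 A0 n0 k0 kCn nA; have [x0 _] := fnk_nuP n k n0 k0.
have := nu_log_ratio n k n0 k0; move: (nu R n k) x0 => x x0 E.
have lx := ln_sublinear x0.
have [xA|xA] := leP x (C * expR A).
  have h : ln n%:R <= x * log_ratio n k x by lra.
  rewrite -(ler_pM2l x0); apply: le_trans h; apply: le_trans nA.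
  by rewrite mulrC ler_wpM2l.
have lC : ln k%:R <= ln C + ln n%:R.
  by rewrite -lnM ?posrE ?ltr0n// ler_ln ?posrE ?mulr_gt0 ?ltr0n.
have : ln (C * expR A) <= ln x by rewrite ler_ln ?posrE ?mulr_gt0 ?expR_gt0 ?ltW.
by rewrite lnM ?posrE ?expR_gt0// expRK /log_ratio; lra.
Qed.

Lemma expR_fnk n k m : (0 < n)%N -> (0 < k)%N ->
  expR (fnk n k m%:R) =
  n%:R * (k%:R / n%:R) ^+ m / m`!%:R * expR (stirling_err R m) :> R.
Proof.
move=> n0 k0.
have N0 : 0 < n%:R :> R by rewrite ltr0n.
have K0 : 0 < k%:R :> R by rewrite ltr0n.
have F0 : 0 < m`!%:R :> R by rewrite ltr0n fact_gt0.
have -> : fnk n k m%:R =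
   ln (n%:R * (k%:R / n%:R) ^+ m / m`!%:R) + stirling_err R m.
  rewrite ln_div ?posrE ?mulr_gt0 ?exprn_gt0 ?divr_gt0//.
  rewrite lnM ?posrE ?exprn_gt0 ?divr_gt0// lnXn ?divr_gt0// ln_div ?posrE//.
  by rewrite -[(_ - _) *+ _]mulr_natl /fnk /stirling_err; ring.
by rewrite expRD lnK// posrE ?divr_gt0 ?mulr_gt0 ?exprn_gt0 ?divr_gt0.
Qed.

(** Combines 'C(k, m) <= k^m / m! with the nonnegative Stirling error. *)
Lemma first_moment_le n k m : (0 < n)%N -> (0 < k)%N -> (0 < m)%N ->
  (n * ('C(k, m) * n ^ (k - m)))%:R / (n ^ k)%:R <= expR (fnk n k m%:R) :> R.
Proof.
move=> n0 k0 m0; have [mk|mk] := leqP m k; last first.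
  by rewrite bin_small// mul0n muln0 mul0r expR_ge0.
have N0 : 0 < n%:R :> R by rewrite ltr0n.
have F0 : 0 < m`!%:R :> R by rewrite ltr0n fact_gt0.
rewrite expR_fnk//.
have err0 : 1 <= expR (stirling_err R m).
  rewrite -expR0 ler_expR; have /andP[h _] := stirling_err_bounds R m m0.
  by apply: le_trans h; rewrite addr_ge0// divr_ge0.
apply: (@le_trans _ _ (n%:R * (k%:R / n%:R) ^+ m / m`!%:R)); last first.
  by rewrite ler_peMr// !mulr_ge0// ?invr_ge0 ?exprn_ge0 ?divr_ge0.
have -> : (n * ('C(k, m) * n ^ (k - m)))%:R / (n ^ k)%:R =
  n%:R * ('C(k, m)%:R / n%:R ^+ m) :> R.
  rewrite -{3}(subnKC mk) expnD !natrM !natrX; field.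
  by rewrite !expf_neq0 ?gt_eqF.
rewrite -mulrA ler_pM2l// expr_div_n ler_pdivlMr// mulrAC.
rewrite ler_pM2r ?invr_gt0 ?exprn_gt0//.
rewrite -natrM -natrX ler_nat bin_ffact ffact_prod.
rewrite -[X in (_ <= _ ^ X)%N]card_ord -prod_nat_const.
by apply: leq_prod => i _; exact: leq_subr.
Qed.

Lemma bernoulli_ineq (t : R) m : t <= 1 -> 1 - m%:R * t <= (1 - t) ^+ m.
Proof.
move=> t1; elim: m => [|m IH]; first by rewrite mul0r subr0 expr0.
rewrite exprS -natr1.
have : (1 - t) * (1 - m%:R * t) <= (1 - t) * (1 - t) ^+ m.
  by rewrite ler_wpM2l// subr_ge0.
have : 0 <= m%:R * t ^+ 2 by rewrite mulr_ge0// sqr_ge0.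
by lra.
Qed.

Lemma leq_sqr2_le k m : (2 * m ^ 2 <= k)%N -> (m <= k)%N.
Proof.
have [->//|m0] := posnP m; apply: leq_trans.
by rewrite -mulnn mulnA leq_pmull// muln_gt0.
Qed.

(** The falling factorial is at least (k - m)^m = k^m (1 - m / k)^m, and Bernoulli's inequality
    bounds the last factor below by 1 - m^2 / k >= 1/2. *)
Lemma ffact_ge_half k m : (0 < k)%N -> (2 * m ^ 2 <= k)%N ->
  k%:R ^+ m / 2 <= (k ^_ m)%:R :> R.
Proof.
move=> k0 mk.
have K0 : 0 < k%:R :> R by rewrite ltr0n.
have mk' := leq_sqr2_le k m mk.
apply: (@le_trans _ _ ((k - m) ^ m)%:R); last first.
  rewrite ler_nat ffact_prod -[X in (_ ^ X <= _)%N]card_ord -prod_nat_const.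
  by apply: leq_prod => i _; apply: leq_sub2l; exact: ltnW.
rewrite natrX natrB//.
have -> : k%:R - m%:R = k%:R * (1 - m%:R / k%:R) :> R by field; rewrite gt_eqF.
rewrite exprMn ler_pM2l ?exprn_gt0//.
apply: le_trans (bernoulli_ineq _ _ _).
  have : m%:R * (m%:R / k%:R) <= 2^-1 :> R.
    rewrite mulrA ler_pdivrMr// ler_pdivlMl//.
    by rewrite -!natrM ler_nat mulnn.
  by lra.
by rewrite ler_pdivrMr// mul1r ler_nat.
Qed.

(** For n >= 2, n / (n - 1) <= 1 + 2 / n <= exp (2 / n). *)
Lemma inv_pred_pow_le n m : (2 <= n)%N ->
  (n%:R / n.-1%:R) ^+ m <= expR (2 * m%:R / n%:R) :> R.
Proof.
move=> n2.
have N0 : 0 < n%:R :> R by rewrite ltr0n (leq_trans _ n2).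
have n1 : 0 < n.-1%:R :> R by rewrite ltr0n; case: n n2 {N0} => [//|[]].
have E : n%:R = n.-1%:R + 1 :> R by rewrite natr1 prednK// (leq_trans _ n2).
have -> : 2 * m%:R / n%:R = 2 / n%:R * m%:R :> R by ring.
rewrite expRM_natr lerXn2r ?nnegrE ?expR_ge0 ?divr_ge0//.
have n2' : 2 <= n%:R :> R by rewrite ler_nat.
apply: le_trans (expR_ge1Dx _).
rewrite ler_pdivrMr// E mulrDl mul1r.
have : n.-1%:R + 1 <= 2 * n.-1%:R :> R by lra.
have n10 : 0 < n.-1%:R + 1 :> R by rewrite addr_gt0.
rewrite -(ler_pM2r (_ : 0 < (n.-1%:R + 1)^-1)) ?invr_gt0// mulfV ?gt_eqF//.
by rewrite mulrAC; lra.
Qed.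

(** Three losses against exp (fnk): at most e from Stirling, e^(2C) from the k - m balls that avoid
    the bin, and 2 from the falling factorial. *)
Lemma second_moment_mean_ge (C : R) n k m :
  (2 <= n)%N -> (0 < k)%N -> (0 < m)%N -> k%:R <= C * n%:R -> (2 * m ^ 2 <= k)%N ->
  expR (fnk n k m%:R - 1 - 2 * C) / 2 <=
  (n * ('C(k, m) * n.-1 ^ (k - m)))%:R / (n ^ k)%:R.
Proof.
move=> n2 k0 m0 kC mk.
have n0 : (0 < n)%N by exact: leq_trans n2.
have N0 : 0 < n%:R :> R by rewrite ltr0n.
have n1 : 0 < n.-1%:R :> R by rewrite ltr0n; case: n n2 {N0 kC n0} => [//|[]].
have F0 : 0 < m`!%:R :> R by rewrite ltr0n fact_gt0.
have mk' := leq_sqr2_le k m mk.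
have -> : (n * ('C(k, m) * n.-1 ^ (k - m)))%:R / (n ^ k)%:R =
  n%:R * (('C(k, m) * m`!)%:R / n%:R ^+ m) / m`!%:R
    * ((n%:R / n.-1%:R) ^+ (k - m))^-1 :> R.
  rewrite -{3}(subnKC mk') expnD !natrM !natrX expr_div_n; field.
  by rewrite !expf_neq0 ?gt_eqF.
rewrite bin_ffact 2!expRD expR_fnk//.
have err1 : expR (stirling_err R m) * expR (- 1) <= 1.
  have /andP[_ h] := stirling_err_bounds R m m0.
  by rewrite -expRD -[leRHS]expR0 ler_expR; lra.
have hp : expR (- (2 * C)) <= ((n%:R / n.-1%:R) ^+ (k - m))^-1.
  rewrite expRN lef_pV2 ?posrE ?expR_gt0 ?exprn_gt0 ?divr_gt0//.
  apply: le_trans (inv_pred_pow_le _ _ n2) _; rewrite ler_expR -mulrA ler_pM2l//.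
  by rewrite ler_pdivrMr//; apply: le_trans kC; rewrite ler_nat leq_subr.
have hf := ffact_ge_half k m k0 mk.
have -> : n%:R * (k%:R / n%:R) ^+ m / m`!%:R * expR (stirling_err R m) * expR (- 1)
   * expR (- (2 * C)) / 2 =
   (n%:R * ((k%:R ^+ m / 2) / n%:R ^+ m) / m`!%:R) *
   (expR (stirling_err R m) * expR (- 1) * expR (- (2 * C))).
  by rewrite expr_div_n; field; rewrite ?expf_neq0 ?gt_eqF.
apply: ler_pM => //.
- by rewrite ler_pM2r ?invr_gt0// ler_pM2l// ler_pM2r ?invr_gt0 ?exprn_gt0.
- by apply: le_trans hp; rewrite -[leRHS]mul1r ler_pM2r ?expR_gt0.
Qed.

Lemma upper_tail (C eps delta : R) : 0 < C -> 0 < eps -> 0 < delta ->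
  exists T : R, forall n k m, (0 < n)%N -> (0 < k)%N -> k%:R <= C * n%:R ->
    T <= ln n%:R -> nu R n k + eps <= m%:R ->
  #|[set b : {ffun 'I_k -> 'I_n} | [exists j, m <= #|fiber b j|]%N]%SET|%:R
    / (n ^ k)%:R <= delta.
Proof.
move=> C0 e0 d0.
have di0 : 0 < delta^-1 by rewrite invr_gt0.
(* A slope of at least A over a distance eps gives [fnk] <= - 1 / delta at m, and exp (- 1 / delta)
   <= delta. *)
pose A := delta^-1 / eps.
have A0 : 0 <= A by rewrite divr_ge0// ltW.
exists (A * (C * expR A)) => n k m n0 k0 kC nA num.
have [x0 fx] := fnk_nuP n k n0 k0.
have LA := log_ratio_large C A n k C0 A0 n0 k0 kC nA.
have m0 : (0 < m)%N by rewrite -(ltr0n R); lra.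
have N0 : 0 < (n ^ k)%:R :> R by rewrite ltr0n expn_gt0 n0.
apply: (@le_trans _ _ (expR (fnk n k m%:R))).
  apply: le_trans (first_moment_le n k m n0 k0 m0).
  rewrite ler_pM2r ?invr_gt0// ler_nat.
  by have := card_exists_fiber_ge 'I_k 'I_n m; rewrite !card_ord.
have xm : nu R n k <= m%:R by lra.
have := fnk_le_tangent n k _ _ x0 xm; rewrite fx.
have h : eps * A <= (m%:R - nu R n k) * log_ratio n k (nu R n k).
  by apply: ler_pM; lra.
have eA : eps * A = delta^-1 by rewrite /A mulrCA mulfV ?mulr1// gt_eqF.
move=> fm; rewrite -[delta]invrK -[leLHS]invrK lef_pV2 ?posrE ?invr_gt0 ?expR_gt0//.
rewrite -expRN; apply: le_trans (expR_ge1Dx _); lra.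
Qed.

Lemma nu_le_ln n k : (0 < n)%N -> (0 < k)%N -> 1 <= nu R n k ->
  2 <= log_ratio n k (nu R n k) -> nu R n k <= ln n%:R.
Proof.
move=> n0 k0 x1 L2; have := nu_log_ratio n k n0 k0.
have : nu R n k * 2 <= nu R n k * log_ratio n k (nu R n k).
  by rewrite ler_pM2l//; lra.
have := ln_ge0 x1; lra.
Qed.

(** Nonnegativity of [fnk] at some m >= 2 forces ln k >= (ln n) / 2 - 1, so k is at least of order
    sqrt n, whereas m is at most ln n. *)
Lemma sqr2_le_of_fnk_ge0 n k m : (0 < n)%N -> (0 < k)%N -> (2 <= m)%N ->
  m%:R <= ln n%:R :> R -> 96 * expR 1 <= ln n%:R :> R -> 0 <= fnk n k m%:R :> R ->
  (2 * m ^ 2 <= k)%N.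
Proof.
move=> n0 k0 m2; have : 2 <= m%:R :> R by rewrite ler_nat.
have : 0 <= ln m%:R :> R by rewrite ln_ge0// ler1n (leq_trans _ m2).
rewrite -(ler_nat R) natrM natrX.
have := @lnK R k%:R; rewrite posrE ltr0n k0 => /(_ isT).
rewrite /fnk; move: (ln k%:R : R) => lk.
move: (ln n%:R : R) (m%:R : R) => t x <-.
move: (ln x) => lx lx0 x2 xt t96 f0.
have x0 : 0 < x by lra.
have lk_ge : t / 2 - 1 <= lk.
  rewrite -(ler_pM2l x0).
  have : 0 <= (x + 2^-1) * lx by rewrite mulr_ge0//; lra.
  have : 0 <= (x - 2) * t by rewrite mulr_ge0; lra.
  by lra.
have e1 : 0 < expR 1 :> R by exact: expR_gt0.
apply: (@le_trans _ _ (expR (t / 2 - 1))); last by rewrite ler_expR.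
have t0 : 0 <= t by lra.
(* From exp (t / 2) >= t^3 / 48, the bound 2 t^2 <= exp (t / 2 - 1) follows once t >= 96 e. *)
have := @expR_ge1Dxn R (t / 2) 2 _; rewrite divr_ge0// => /(_ isT).
have -> : expR (t / 2) = expR (t / 2 - 1) * expR 1.
  by rewrite -expRD subrK.
rewrite factE/= => h.
rewrite -(ler_pM2r e1).
have : t ^+ 2 * (96 * expR 1) <= t ^+ 2 * t by rewrite ler_wpM2l ?sqr_ge0.
have : x ^+ 2 * expR 1 <= t ^+ 2 * expR 1.
  by rewrite ler_pM2r// lerXn2r ?nnegrE; lra.
move: h; rewrite (_ : (t / 2) ^+ 3 / 6 = t ^+ 2 * t / 48); last by field.
by move: (t ^+ 2 * t) => *; lra.
Qed.

Lemma lower_tail (C eps delta : R) : 0 < C -> 0 < eps -> eps <= 1 -> 0 < delta ->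
  exists T : R, forall n k m, (0 < n)%N -> (0 < k)%N -> k%:R <= C * n%:R ->
    T <= ln n%:R -> (2 <= m)%N -> m%:R <= nu R n k - eps < m%:R + 1 ->
  #|[set b : {ffun 'I_k -> 'I_n} | [forall j, #|fiber b j| != m]%N]%SET|%:R
    / (n ^ k)%:R <= delta.
Proof.
move=> C0 e0 e1 d0.
have di0 : 0 < delta^-1 by rewrite invr_gt0.
have ln2 : 0 <= ln 2 :> R by rewrite ln_ge0// ler1n.
(* The 2 yields nu <= ln n. The ln 2 pays for moving the slope from nu down to m, as nu < m + 1 +
   eps <= 2 m. The quotient makes [fnk] at m at least 1 + 2 C + 4 / delta, hence the mean at least 2
   / delta. *)
pose A := 2 + ln 2 + (1 + 2 * C + 4 * delta^-1) / eps.
have A0 : 2 + ln 2 <= A by rewrite lerDl divr_ge0//; lra.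
have ld0 : 0 < ln (1 + delta / 2) by rewrite ln_gt0//; lra.
(* The summands serve [log_ratio_large], [sqr2_le_of_fnk_ge0] and the closing estimate of (n / (n -
   1))^(2m), in this order. *)
pose T := A * (C * expR A) + 96 * expR 1 + 8 / ln (1 + delta / 2).
have T1 : 0 <= A * (C * expR A) by rewrite !mulr_ge0 ?expR_ge0//; lra.
have T2 : 1 < expR 1 :> R by rewrite expR_gt1.
have T3 : 0 <= 8 / ln (1 + delta / 2) by rewrite divr_ge0// ltW.
exists T => n k m n0 k0 kC; rewrite /T => nT m2 /andP[mx xm].
have [x0 fx] := fnk_nuP n k n0 k0.
have LA : A <= log_ratio n k (nu R n k).
  by apply: (log_ratio_large C) => //; lra.
have M2 : 2 <= m%:R :> R by rewrite ler_nat.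
have xt : nu R n k <= ln n%:R by apply: nu_le_ln => //; lra.
have lx : ln (nu R n k) <= ln 2 + ln m%:R.
  by rewrite -lnM ?posrE ?ler_ln ?posrE ?mulr_gt0//; lra.
have fm : 1 + 2 * C + 4 * delta^-1 <= fnk n k m%:R.
  have M0 : 0 < m%:R :> R by lra.
  have mx' : m%:R <= nu R n k by lra.
  (* The tangent is taken at m, the smaller point, so the zero at nu bounds [fnk] at m from
     below. *)
  have := fnk_le_tangent n k _ _ M0 mx'; rewrite fx.
  have : eps * (A - ln 2) <= (nu R n k - m%:R) * log_ratio n k m%:R.
    by apply: ler_pM; move: LA lx; rewrite /log_ratio; lra.
  have -> : eps * (A - ln 2) = 2 * eps + (1 + 2 * C + 4 * delta^-1).
    by rewrite /A; field; rewrite !gt_eqF.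
  lra.
have mk : (2 * m ^ 2 <= k)%N by apply: (sqr2_le_of_fnk_ge0 n) => //; lra.
have n2 : (2 <= n)%N.
  rewrite ltnNge; apply/negP => n1.
  have : ln n%:R <= ln 1 :> R by rewrite ler_ln ?posrE ?ltr0n// lern1.
  by rewrite ln1; lra.
have mmk : (m + m <= k)%N.
  apply: leq_trans mk; rewrite addnn -mul2n leq_mul2l/= -mulnn.
  by rewrite leq_pmulr// (leq_trans _ m2).
pose mu : R := (n * ('C(k, m) * n.-1 ^ (k - m)))%:R / (n ^ k)%:R.
have := @card_no_fiber_eq R 'I_k 'I_n m mu; rewrite !card_ord.
move=> /(_ n2 mmk erefl) /le_trans; apply.
have mu_ge : 2 / delta <= mu.
  have m0 : (0 < m)%N by exact: leq_trans m2.
  apply: le_trans (second_moment_mean_ge C n k m n2 k0 m0 kC mk).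
  rewrite ler_pdivlMr//; apply: le_trans (expR_ge1Dx _); lra.
have d20 : 0 < 2 / delta by rewrite divr_gt0.
have muV : mu^-1 <= delta / 2.
  by rewrite -[delta / 2]invf_div lef_pV2 ?posrE// (lt_le_trans d20).
suff : (n%:R / n.-1%:R) ^+ (m + m) <= 1 + delta / 2 :> R by lra.
apply: le_trans (inv_pred_pow_le _ _ n2) _.
rewrite -[leRHS]lnK ?posrE ?addr_gt0 ?divr_gt0// ler_expR.
have N0 : 0 < n%:R :> R by rewrite ltr0n.
rewrite ler_pdivrMr// natrD.
apply: (@le_trans _ _ (4 * ln n%:R)); first by lra.
set t := ln n%:R in nT xt *.
have t0 : 0 < t by lra.
(* With l = ln (1 + delta / 2) and t >= 8 / l, this gives 4 t <= l t^2 / 2 <= l n. *)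
have : 1 + t ^+ 2 / 2 <= n%:R.
  have := @expR_ge1Dxn R t 1 (ltW t0).
  by rewrite /t lnK// posrE.
have : 8 <= ln (1 + delta / 2) * t.
  by rewrite mulrC -ler_pdivrMr//; lra.
move: (ln (1 + delta / 2)) ld0 => l l0 lt nt.
apply: (@le_trans _ _ (l * (t ^+ 2 / 2))); last by rewrite ler_pM2l//; lra.
have : 8 * t <= l * t * t by rewrite ler_pM2r.
by rewrite expr2; lra.
Qed.

End Asymptotics.

(** * Concentration of the maximum load, by counting *)

Lemma max_load_fiber n k (b : {ffun 'I_k -> 'I_n}) :
  max_load n (fun i => b i : nat) = (\max_(j < n) #|fiber b j|)%N.
Proof. by apply: eq_bigr => j _; apply: eq_card => i; rewrite !inE val_eqE. Qed.

Lemma concentration_count (R : realType) (C eps delta : R) :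
  0 < C -> 0 < eps -> 0 < delta ->
  exists T : R, forall n k : nat, (0 < n)%N -> (0 < k)%N -> k%:R <= C * n%:R ->
    T <= ln n%:R ->
  1 - delta <= #|[set b : {ffun 'I_k -> 'I_n} |
      Num.floor (nu R n k - eps) <= (max_load n (fun i => b i : nat))%:Z
        <= Num.floor (nu R n k + eps)]%SET|%:R / (n ^ k)%:R.
Proof.
move=> C0 e0 d0; have d20 : 0 < delta / 2 by rewrite divr_gt0.
(* [lower_tail] asks for eps <= 1; shrinking eps only raises the lower bound to be proved. *)
pose eps' := Num.min eps 1.
have e'0 : 0 < eps' by rewrite lt_min e0 ltr01.
have e'1 : eps' <= 1 by rewrite ge_min lexx orbT.
have e'e : eps' <= eps by rewrite ge_min lexx.
have [T1 up] := upper_tail R C eps _ C0 e0 d20.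
have [T2 low] := lower_tail R C eps' _ C0 e'0 e'1 d20.
exists (Num.max T1 T2) => n k n0 k0 kC; rewrite ge_max => /andP[nT1 nT2].
have [x0 _] := fnk_nuP R n k n0 k0.
set good := [set b | _]%SET.
(* The least integer above nu + eps. The absolute values only convert to naturals: [m1] matters only
   where the floor is at least 2. *)
pose m2 := `|(Num.floor (nu R n k + eps) + 1)%R|%N.
pose m1 := `|Num.floor (nu R n k - eps')|%N.
pose bad2 := [set b : {ffun 'I_k -> 'I_n} | [exists j, m2 <= #|fiber b j|]%N]%SET.
(* When the floor is at most 1 the lower bound cannot fail, because k > 0 puts a ball in some
   bin. *)
pose bad1 := if (2 <= Num.floor (nu R n k - eps')) then
  [set b : {ffun 'I_k -> 'I_n} | [forall j, #|fiber b j| != m1]%N]%SET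
  else finset.set0.
have f2 : 0 <= Num.floor (nu R n k + eps) by rewrite floor_ge0; lra.
have m2E : m2%:Z = Num.floor (nu R n k + eps) + 1.
  exact: gez0_abs (addr_ge0 f2 ler01).
have cov : ([set: {ffun 'I_k -> 'I_n}] \subset good :|: (bad1 :|: bad2))%SET.
  apply/fintype.subsetP => b _; rewrite !finset.in_setU.
  have [//|/=] := boolP (b \in good).
  rewrite inE max_load_fiber negb_and -!ltNge => /orP[H|H].
    have {}H : (\max_(j < n) #|fiber b j|)%:Z < Num.floor (nu R n k - eps').
      by apply: lt_le_trans H _; apply: le_floor; lra.
    apply/orP; left; rewrite /bad1; case: ifPn => [z2|].
      have m1E : m1%:Z = Num.floor (nu R n k - eps') by exact: gez0_abs (le_trans _ z2).
      rewrite inE; apply/forallP => j; rewrite neq_ltn; apply/orP; left.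
      move: H; rewrite -m1E ltz_nat; apply: leq_ltn_trans.
      exact: (leq_bigmax (F := fun j => #|fiber b j|)).
    rewrite -ltNge => z2; exfalso.
    have : (\max_(j < n) #|fiber b j|)%:Z < 1%:Z.
      by apply: lt_le_trans H _; rewrite -ltzD1.
    rewrite ltz_nat ltnS leqn0 => /eqP M0.
    pose i0 : 'I_k := Ordinal k0.
    have := leq_bigmax (F := fun j => #|fiber b j|) (b i0).
    rewrite M0 leqn0 cards_eq0 => /eqP/setP/(_ i0).
    by rewrite in_fiber eqxx finset.in_set0.
  apply/orP; right; rewrite inE; apply/existsP.
  have [|j jE] := @bigop.eq_bigmax 'I_n (fun j => #|fiber b j|).
    by rewrite card_ord.
  by exists j; rewrite -jE -lez_nat m2E lezD1.
have N0 : 0 < (n ^ k)%:R :> R by rewrite ltr0n expn_gt0 n0.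
have b2 : #|bad2|%:R / (n ^ k)%:R <= delta / 2.
  apply: up => //; rewrite -[m2%:R]/(m2%:Z%:~R) m2E.
  exact/ltW/floorD1_gt.
have b1 : #|bad1|%:R / (n ^ k)%:R <= delta / 2.
  rewrite /bad1; case: ifPn => [z2|_]; last by rewrite cards0 mul0r ltW.
  have m1E : m1%:Z = Num.floor (nu R n k - eps') by exact: gez0_abs (le_trans _ z2).
  apply: low => //; first by rewrite -lez_nat m1E.
  rewrite -[m1%:R]/(m1%:Z%:~R) m1E -intrD1.
  by rewrite floor_le floorD1_gt.
have := subset_leq_card cov; rewrite cardsT card_ffun !card_ord => h.
have {}h : (n ^ k)%:R <= #|good|%:R + (#|bad1|%:R + #|bad2|%:R) :> R.
  rewrite -!natrD ler_nat; apply: leq_trans h _.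
  apply: leq_trans (leq_card_setU _ _) _; rewrite leq_add2l.
  exact: leq_card_setU.
move: b1 b2; rewrite !ler_pdivrMr// ler_pdivlMr// => b1 b2; lra.
Qed.

(** * From counting to probability *)

Section UniformAssignment.
Variables (R : realType) (d : measure_display) (T : measurableType d).
Variables (P : probability T R) (n k : nat) (X : 'I_k -> {RV P >-> nat}).

Definition assignment_event (c : 'I_k -> nat) : set T :=
  \bigcap_(i in [set` [set: 'I_k]%SET]) (X i @^-1` [set c i]).

Lemma assignment_eventP (c : 'I_k -> nat) (w : T) :
  assignment_event c w <-> (fun i => X i w) = c.
Proof.
split=> [H|<-//]; apply/funext => i.
by apply: H; rewrite /= finset.in_setT.
Qed.

Lemma measurable_assignment_event (c : 'I_k -> nat) :
  measurable (assignment_event c).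
Proof.
apply: fin_bigcap_measurable; first exact: finite_finpred.
by move=> i _; exact: measurable_funPTI.
Qed.

(** The event is a countable union of assignment events: there are countably many maps from the k
    balls to the naturals. *)
Lemma measurable_assignment_pred (Q : pred ('I_k -> nat)) :
  measurable [set w | Q (fun i => X i w)].
Proof.
rewrite (_ : [set w | _] = \bigcup_(c : {ffun 'I_k -> nat})
   (if Q c then assignment_event c else set0)).
  apply: countable_bigcupT_measurable; first exact: countableP.
  by move=> c; case: ifPn => // _; exact: measurable_assignment_event.
apply/seteqP; split=> [w /= Qw|w [c _]].
  exists [ffun i => X i w] => //.
  have -> : [ffun i => X i w] = (fun i => X i w) :> ('I_k -> nat).
    by apply/funext => i; rewrite ffunE.
  by rewrite Qw; exact/assignment_eventP.
by case: ifPn => // Qc /assignment_eventP /= ->.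
Qed.

Hypothesis X_indep : mutually_independent X.
Hypothesis X_unif : forall i, uniform_bin n (X i).

Lemma prob_assignment_event (b : {ffun 'I_k -> 'I_n}) :
  P (assignment_event (fun i => b i)) = ((n ^ k)%:R^-1)%:E.
Proof.
rewrite X_indep// (eq_bigr (fun=> (n%:R^-1)%:E)); last first.
  by move=> i _; rewrite X_unif.
by rewrite prodEFin prodr_const cardsT card_ord natrX exprVn.
Qed.

(** The assignment events are disjoint, each of probability n^(-k). Outcomes with a label n or
    larger are dropped, hence an inequality; it suffices for a limit equal to 1. *)
Lemma prob_assignment_pred_ge (Q : pred ('I_k -> nat)) :
  ((#|[set b : {ffun 'I_k -> 'I_n} | Q (fun i => b i : nat)]%SET|%:R
     / (n ^ k)%:R)%:E <= P [set w | Q (fun i => X i w)])%E.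
Proof.
set S := [set b | _]%SET.
pose E (b : {ffun 'I_k -> 'I_n}) := assignment_event (fun i => b i).
have -> : ((#|S|%:R / (n ^ k)%:R)%:E = P (\bigcup_(b in [set` S]) E b))%E.
  rewrite measure_fin_bigcup; first last.
  - by move=> b _; exact: measurable_assignment_event.
  - move=> b b' _ _ [w [/assignment_eventP bw /assignment_eventP b'w]].
    apply/ffunP => i; apply/val_inj.
    by have := congr1 (fun f => f i) (etrans (esym bw) b'w).
  - exact: finite_finpred.
  rewrite -(@bigfs _ _ _ _ (index_enum _)) ?index_enum_uniq//; last first.
    by move=> b _; rewrite mem_index_enum.
  rewrite (eq_bigr (fun=> ((n ^ k)%:R^-1)%:E)); last first.
    by move=> b _; exact: prob_assignment_event.
  by rewrite sumEFin sumr_const mulr_natl.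
apply: le_measure; rewrite ?inE.
- apply: fin_bigcup_measurable; first exact: finite_finpred.
  by move=> b _; exact: measurable_assignment_event.
- exact: measurable_assignment_pred.
- move=> w [b /= bS /assignment_eventP ->].
  by move: bS; rewrite inE.
Qed.

End UniformAssignment.

(* For each n, [X n i] is the bin receiving the i-th of k n balls. *)
Theorem theorem4p1 (R : realType) (k : nat -> nat) (eps : R)
    (d : nat -> measure_display) (T : forall n : nat, measurableType (d n))
    (P : forall n : nat, probability (T n) R)
    (X : forall n : nat, 'I_(k n) -> {RV (P n) >-> nat})
    (k_gt0 : forall n : nat, (0 < n)%N -> (0 < k n)%N)
    (k_bigO : (fun n : nat => (k n)%:R : R) =O_\oo (fun n : nat => n%:R : R))
    (eps_gt0 : 0 < eps)
    (X_indep : forall n : nat, (0 < n)%N -> mutually_independent (X n))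
    (X_unif : forall n : nat, (0 < n)%N -> forall i : 'I_(k n),
        uniform_bin n (X n i)) :
  P n [set w : T n |
        Num.floor (nu R n (k n) - eps)
          <= (max_load n (fun i : 'I_(k n) => X n i w))%:Z
          <= Num.floor (nu R n (k n) + eps)] @[n --> \oo] --> 1%:E.
Proof.
have /eqO_exP[C C0 kC] := k_bigO.
pose Q n (c : 'I_(k n) -> nat) := Num.floor (nu R n (k n) - eps)
  <= (max_load n c)%:Z <= Num.floor (nu R n (k n) + eps).
have mW n : measurable [set w : T n | Q n (fun i => X n i w)].
  exact: measurable_assignment_pred.
have W1 n := probability_le1 (P n) (mW n).
have Wfin n : P n [set w : T n | Q n (fun i => X n i w)] \is a fin_num.
  by apply: fin_num_measure.
apply/fine_cvgP; split; first by apply: nearW => n; exact: Wfin.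
apply/cvgrPdist_le => delta d0.
(* The threshold [T0] depends on neither n nor k, so it applies along the sequence [k n]. *)
have [T0 HT] := concentration_count R C eps delta C0 eps_gt0 d0.
near=> n.
have n0 : (0 < n)%N by near: n; exact: nbhs_infty_gt.
have nT : T0 <= ln n%:R.
  rewrite -[T0]expRK ler_ln ?posrE ?expR_gt0 ?ltr0n//.
  by near: n; exact: nbhs_infty_ger.
have kn : (k n)%:R <= C * n%:R.
  have : `|(k n)%:R : R| <= C * `|n%:R : R| by near: n; exact: kC.
  by rewrite !normr_nat.
have h := HT n (k n) n0 (k_gt0 n n0) kn nT.
have := prob_assignment_pred_ge R _ _ (P n) n (k n) (X n)
  (X_indep n n0) (X_unif n n0) (Q n).
rewrite /= -[X in (_ <= X)%E]fineK// lee_fin => h2.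
have := W1 n; rewrite -[leLHS]fineK// lee_fin => h3.
(* A probability is at most 1, so only the lower bound 1 - delta remains to be used. *)
rewrite ger0_norm ?subr_ge0//.
have := le_trans h h2.
rewrite /Q; lra.
Unshelve. all: by end_near.
Qed.
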